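(* Let $G$ be a locally finite graph, let $u,w\in V(G)$ be vertices and let $U,W\subset V(G)$ be finite sets with $u\in U$, $w\in W$ and $U\cap W=\emptyset$. Then \[ P_{E^{1/2}}(C_u=U,\ C_w=W)=P_O(\overrightarrow{C}_u=U,\ \overleftarrow{C}_w=W)=P_{D^{1/2}}(\overrightarrow{C}_u=U,\ \overleftarrow{C}_w=W),\] and \[ P_{E^{p}}(C_u=U,\ C_w=W)=P_{D^{p}}(\overrightarrow{C}_u=U,\ \overleftarrow{C}_w=W)\quad\text{for every } 0\le p\le 1.\]
   Context: $G$ is a fixed undirected graph. Three random models on $G$ are considered; $P_M$ denotes probability in model $M$. Model $E^p$ (edge percolation), $0\le p\le 1$: every edge of $G$ exists with probability $p$, independently of the other edges. For a vertex $v$, the cluster $C_v=C_v(G)\subseteq V(G)$ is the random set of all vertices $x$ for which there is a path of existing edges between $v$ and $x$ (so $v\in C_v$). Model $O$ (random orientation): every edge of $G$ is directed in one of its two possible directions, each with probability $1/2$, independently of all other edges. Model $D^p$ (directed edge percolation), $0\le p\le 1$: every edge of $G$ is replaced by two directed edges with opposite directions, and each of these directed edges exists with probability $p$, independently of all other directed edges. In models $O$ and $D^p$, for a vertex $v$, the out-cluster $\overrightarrow{C}_v=\overrightarrow{C}_v(G)\subseteq V(G)$ is the random set of all vertices $x$ for which there is a directed path from $v$ to $x$, and the in-cluster $\overleftarrow{C}_v=\overleftarrow{C}_v(G)\subseteq V(G)$ is the random set of all vertices $x$ for which there is a directed path from $x$ to $v$. By convention $v\in\overleftarrow{C}_v\cap\overrightarrow{C}_v$.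 All clusters are sets of vertices. *)

(* Defs.v *)
From mathcomp Require Import all_boot all_order all_algebra.
From mathcomp Require Import finmap.
From mathcomp Require Import all_classical all_reals all_analysis.

Set Implicit Arguments.
Unset Strict Implicit.
Unset Printing Implicit Defensive.

Local Open Scope classical_set_scope.
Local Open Scope ring_scope.

Record ugraph (V : Type) := UGraph {
  adj : V -> V -> Prop;
  adj_sym : forall x y, adj x y -> adj y x;
  adj_irrefl : forall x, ~ adj x x }.

Definition locally_finite (V : Type) (G : ugraph V) : Prop :=
  forall v, finite_set [set x | adj G v x].

(* The undirected edge between x and y is the unordered pair [set x; y]. *)
Definition edges (V : Type) (G : ugraph V) : set (set V) :=
  [set e | exists x y, adj G x y /\ e = [set x; y]].

(* The directed edges (x, y), from x to y: two for each undirected edge. *)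
Definition arcs (V : Type) (G : ugraph V) : set (V * V) :=
  [set a | adj G a.1 a.2].

(* The vertices y such that there is a (directed) r-path from x to y; the path
   may be empty, hence out_cluster r x x and in_cluster r x x always hold. *)
Definition reachable (V : Type) (r : V -> V -> Prop) (x y : V) : Prop :=
  exists s : seq V, path (fun a b => `[< r a b >]) x s /\ last x s = y.

Definition out_cluster (V : Type) (r : V -> V -> Prop) (v : V) : set V :=
  [set x | reachable r v x].

Definition in_cluster (V : Type) (r : V -> V -> Prop) (v : V) : set V :=
  [set x | reachable r x v].

(* S carries the discrete sigma-algebra, here and in mutually_independent. *)
Definition discrete_random (d : measure_display) (T : measurableType d)
    (S : Type) (X : T -> S) : Prop :=
  forall B : set S, measurable (X @^-1` B).

Definition mutually_independent (R : realType) (d : measure_display)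
    (T : measurableType d) (P : probability T R) (I : choiceType) (S : Type)
    (D : set I) (X : I -> T -> S) : Prop :=
  forall (J : {fset I}) (B : I -> set S), [set` J] `<=` D ->
    P (\bigcap_(i in [set` J]) (X i @^-1` B i))
    = (\prod_(i <- J) P (X i @^-1` B i))%E.

(* Each of the models below is a property of a family of random elements on an
   arbitrary probability space. Values at indices that are not edges (or
   arcs) of G are unconstrained and are never used by the clusters. *)

(* X e = true when the edge e exists. *)
Record edge_percolation (R : realType) (V : choiceType) (G : ugraph V) (p : R)
    (d : measure_display) (T : measurableType d) (P : probability T R)
    (X : set V -> T -> bool) : Prop := EdgePercolation {
  ep_meas : forall e, edges G e -> discrete_random (X e);
  ep_law : forall e, edges G e -> P [set t | X e t] = p%:E;
  ep_indep : mutually_independent P (edges G) X }.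

Definition open_edge (V : choiceType) (G : ugraph V) (T : Type)
    (X : set V -> T -> bool) (t : T) (x y : V) : Prop :=
  adj G x y /\ X [set x; y] t.

(* The relation open_edge X t is symmetric, so in_cluster would do as well. *)
Definition edge_cluster (V : choiceType) (G : ugraph V) (T : Type)
    (X : set V -> T -> bool) (t : T) (v : V) : set V :=
  out_cluster (open_edge G X t) v.

(* h e is the endpoint of e towards which e is directed. *)
Record random_orientation (R : realType) (V : choiceType) (G : ugraph V)
    (d : measure_display) (T : measurableType d) (P : probability T R)
    (h : set V -> T -> V) : Prop := RandomOrientation {
  ro_head : forall e t, edges G e -> e (h e t);
  ro_meas : forall e, edges G e -> discrete_random (h e);
  ro_law : forall e x, edges G e -> e x -> P [set t | h e t = x] = (2^-1)%:E;
  ro_indep : mutually_independent P (edges G) h }.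

Definition oriented_edge (V : choiceType) (G : ugraph V) (T : Type)
    (h : set V -> T -> V) (t : T) (x y : V) : Prop :=
  adj G x y /\ h [set x; y] t = y.

(* Y (x, y) = true when the directed edge from x to y exists. *)
Record directed_percolation (R : realType) (V : choiceType) (G : ugraph V)
    (p : R) (d : measure_display) (T : measurableType d) (P : probability T R)
    (Y : V * V -> T -> bool) : Prop := DirectedPercolation {
  dp_meas : forall a, arcs G a -> discrete_random (Y a);
  dp_law : forall a, arcs G a -> P [set t | Y a t] = p%:E;
  dp_indep : mutually_independent P (arcs G) Y }.

Definition open_arc (V : choiceType) (G : ugraph V) (T : Type)
    (Y : V * V -> T -> bool) (t : T) (x y : V) : Prop :=
  adj G x y /\ Y (x, y) t.

(* Main.v *)
Require Import Defs.
From mathcomp Require Import all_boot all_order all_algebra.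
From mathcomp Require Import finmap.
From mathcomp Require Import all_classical all_reals all_analysis.

Local Open Scope classical_set_scope.
Local Open Scope ring_scope.

(** Explore the out-cluster of [u] and the in-cluster of [w] by querying arcs
    one at a time: an arc is queried only when its tail has been reached from
    [u] and its head has not, or when its head is known to lead to [w] and its
    tail is not.  The exploration stops as soon as it finds a vertex of the
    out-cluster outside [U] or a vertex of the in-cluster outside [W].  As long
    as it runs, the two explored sets are disjoint because [U] and [W] are, and
    then no arc is queried after its opposite.  Indeed, if an arc was queried
    because its tail is reached from [u], then the opposite arc leads to a
    vertex already explored from [u], and it cannot serve the exploration from
    [w], whose set would have to contain that same vertex; the other case is
    symmetric.

    Hence all that matters about a random relation on the vertices is its law
    along finite sets of arcs containing no two opposite ones.  In each of the
    three models such arcs are independently open with probability [p] (with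
    [p = 1/2] for orientations), because they belong to distinct independent
    random elements; this is [arcwise_bernoulli], obtained for the three models
    from [arcwise_bernoulli_indep].  What the models do to a pair of opposite
    arcs, namely open both at once, exactly one, or each independently, is
    never seen.

    Local finiteness makes the arcs that can be queried finite in number, so
    the decision tree of the exploration is finite, and adding up the
    probabilities of its leaves gives the same value for any two models with
    the same [p] ([cluster_law_eq]). *)

(** * Reachability *)

Lemma out_cluster_root {V : Type} (r : V -> V -> Prop) (x : V) :
  out_cluster r x x.
Proof. by exists [::]. Qed.

Lemma out_cluster_step {V : Type} (r : V -> V -> Prop) {u x y : V} :
  out_cluster r u x -> r x y -> out_cluster r u y.
Proof.
move=> [s [ps ls]] rxy; exists (rcons s y).
by rewrite rcons_path last_rcons ps ls; split => //; apply/asboolP.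
Qed.

Lemma out_cluster_min {V : Type} (r : V -> V -> Prop) (u : V) (A : set V) :
  A u -> (forall x y, A x -> r x y -> A y) -> out_cluster r u `<=` A.
Proof.
move=> Au Ar x [s [ps <-]]; elim: s u Au ps => [//|y s IHs] u Au /=.
by move=> /andP[/asboolP ruy ps]; apply: IHs ps; apply: Ar ruy.
Qed.

Lemma in_cluster_root {V : Type} (r : V -> V -> Prop) (x : V) :
  in_cluster r x x.
Proof. by exists [::]. Qed.

Lemma in_cluster_step {V : Type} (r : V -> V -> Prop) {w x y : V} :
  in_cluster r w y -> r x y -> in_cluster r w x.
Proof.
move=> [s [ps ls]] rxy; exists (y :: s); split => //=.
by rewrite ps andbT; apply/asboolP.
Qed.

Lemma in_cluster_min {V : Type} (r : V -> V -> Prop) (w : V) (A : set V) :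
  A w -> (forall x y, A y -> r x y -> A x) -> in_cluster r w `<=` A.
Proof.
move=> Aw Ar x [s [ps ls]]; elim: s x ps ls => [x _ /= -> //|y s IHs] x /=.
by move=> /andP[/asboolP rxy ps] ls; apply: Ar rxy; apply: IHs.
Qed.

Lemma out_cluster_mono {V : Type} {r r' : V -> V -> Prop} (u : V) :
  (forall x y, r x y -> r' x y) -> out_cluster r u `<=` out_cluster r' u.
Proof.
move=> rr'; apply: out_cluster_min; first exact: out_cluster_root.
by move=> x y ux /rr'; apply: out_cluster_step.
Qed.

Lemma in_cluster_mono {V : Type} {r r' : V -> V -> Prop} (w : V) :
  (forall x y, r x y -> r' x y) -> in_cluster r w `<=` in_cluster r' w.
Proof.
move=> rr'; apply: in_cluster_min; first exact: in_cluster_root.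
by move=> x y wy /rr'; apply: in_cluster_step.
Qed.

Lemma in_cluster_sym {V : Type} (r : V -> V -> Prop) (v : V) :
  (forall x y, r x y -> r y x) -> in_cluster r v = out_cluster r v.
Proof.
move=> rC; apply/seteqP; split.
  apply: in_cluster_min; first exact: out_cluster_root.
  by move=> x y vy /rC; apply: out_cluster_step.
apply: out_cluster_min; first exact: in_cluster_root.
by move=> x y vx /rC; apply: in_cluster_step.
Qed.

(** * Random relations whose arcs are independently open *)

Definition asymmetric_arcs {V : choiceType} (J : {fset V * V}) : Prop :=
  forall x y, (x, y) \in J -> (y, x) \notin J.

Definition cylinder {V : choiceType} {T : Type} (r : T -> V -> V -> Prop)
    (J : {fset V * V}) (b : V * V -> bool) : set T :=
  [set t | forall a, a \in J -> r t a.1 a.2 <-> b a].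

(** The joint law of two opposite arcs is left free: it is the only feature
    that tells the three models apart. *)
Record arcwise_bernoulli {R : realType} {V : choiceType} (G : ugraph V) (p : R)
    {d : measure_display} {T : measurableType d} (P : probability T R)
    (r : T -> V -> V -> Prop) : Prop := ArcwiseBernoulli {
  ab_adj : forall t x y, r t x y -> adj G x y;
  ab_meas : forall (J : {fset V * V}) b,
    [set` J] `<=` arcs G -> measurable (cylinder r J b);
  ab_law : forall (J : {fset V * V}) b,
    [set` J] `<=` arcs G -> asymmetric_arcs J ->
    P (cylinder r J b) = (\prod_(a <- J) (if b a then p else 1 - p)%:E)%E }.

(** A random relation is read off an independent family [X] when the arc [a] is
    open iff the value of [X] at [f a] lies in [B a].  As [f] identifies at
    most opposite arcs, it is injective on asymmetric sets of arcs, and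
    independence of the family turns into independence of the arcs. *)
Lemma arcwise_bernoulli_indep {R : realType} {V : choiceType} (G : ugraph V)
    (p : R) {d : measure_display} {T : measurableType d} (P : probability T R)
    {I : choiceType} {S : Type} (D : set I) (X : I -> T -> S)
    (f : V * V -> I) (B : V * V -> set S) (r : T -> V -> V -> Prop) :
  (forall i, D i -> discrete_random (X i)) ->
  mutually_independent P D X ->
  (forall a, arcs G a -> D (f a)) ->
  (forall a a', arcs G a -> arcs G a' -> f a = f a' ->
    a' = a \/ a' = (a.2, a.1)) ->
  (forall a, arcs G a -> P (X (f a) @^-1` B a) = p%:E) ->
  (forall t x y, r t x y <-> adj G x y /\ B (x, y) (X (f (x, y)) t)) ->
  arcwise_bernoulli G p P r.
Proof.
move=> Xmeas Xind fD finj Xlaw rE.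
pose C (b : V * V -> bool) a : set S := [set s | B a s <-> b a].
have cylE (J : {fset V * V}) (b : V * V -> bool) : [set` J] `<=` arcs G ->
    cylinder r J b = \bigcap_(a in [set` J]) (X (f a) @^-1` C b a).
  move=> JG; apply/seteqP; split => t Jt a aJ; have aG := JG _ aJ.
    have [rb br] := Jt a aJ; split.
      by move=> Ba; apply: rb; apply/rE; case: (a) aG Ba.
    by move=> /br /rE[_]; case: (a).
  have [Bb bB] := Jt a aJ; split.
    by move=> /rE[_ Ba]; apply: Bb; case: (a) Ba.
  by move=> /bB Ba; apply/rE; case: (a) aG Ba.
have Claw (b : V * V -> bool) a : arcs G a ->
    P (X (f a) @^-1` C b a) = (if b a then p else 1 - p)%:E.
  move=> aG; case: ifPn => ba.
    rewrite -(Xlaw _ aG); congr (P _); apply/seteqP; split => t /=.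
      by move=> [_]; apply.
    by move=> Ba; split.
  rewrite EFinB -(Xlaw _ aG) -probability_setC; last exact: Xmeas (fD _ aG) _.
  congr (P _); apply/seteqP; split => t /=.
    by move=> [Bb _] /Bb; apply/negP.
  by move=> nB; split => // /(negP ba).
split => [t x y /rE[]//|J b JG|J b JG Jasym].
  rewrite cylE //; apply: fin_bigcap_measurable; first exact: finite_fset.
  by move=> a /JG aG; apply: Xmeas (fD _ aG) _.
have fJ : {in J &, injective f}.
  move=> [x y] [x' y'] aJ aJ' /(finj _ _ (JG _ aJ) (JG _ aJ')) [<-//|e].
  by have := Jasym _ _ aJ; rewrite -[(y, x)]e aJ'.
(* On the image of J, a condition at i amounts to one at its only preimage. *)
pose E i : set S := [set s | forall a, a \in J -> f a = i -> C b a s].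
have -> : cylinder r J b
    = \bigcap_(i in [set` [fset f a | a in J]%fset]) (X i @^-1` E i).
  rewrite cylE //; apply/seteqP; split => t Jt.
    by move=> i _ a aJ <-; apply: Jt.
  move=> a aJ; apply: (Jt (f a)) => //=.
  by apply/imfsetP; exists a.
rewrite Xind; last by move=> i /= /imfsetP[a /= /JG /fD ? ->].
rewrite big_imfset //=; apply: eq_big_seq => a aJ.
rewrite -Claw; last exact: JG.
congr (P _); apply/seteqP; split => t /=; first exact.
by move=> Ca a' a'J /(fJ _ _ a'J aJ) ->.
Qed.

Lemma edges_arc {V : choiceType} (G : ugraph V) (a : V * V) :
  arcs G a -> edges G [set a.1; a.2].
Proof. by move=> aG; exists a.1, a.2. Qed.

Lemma edge_arc_inj {V : choiceType} (G : ugraph V) (a a' : V * V) :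
  arcs G a -> arcs G a' -> [set a.1; a.2] = [set a'.1; a'.2] ->
  a' = a \/ a' = (a.2, a.1).
Proof.
case: a a' => [x y] [x' y'] xy x'y' /= e.
have : [set x; y] x' by rewrite e; left.
have : [set x; y] y' by rewrite e; right.
by move=> [ey|ey] [ex|ex]; move: x'y'; rewrite /arcs /= ex ey;
  [move=> /(@adj_irrefl _ G)|right|left|move=> /(@adj_irrefl _ G)].
Qed.

(** * The three models *)

Lemma edge_percolation_bernoulli {R : realType} {V : choiceType}
    {G : ugraph V} {p : R} {d : measure_display} {T : measurableType d}
    {P : probability T R} {X : set V -> T -> bool} :
  edge_percolation G p P X -> arcwise_bernoulli G p P (open_edge G X).
Proof.
move=> [Xmeas Xlaw Xind].
apply: (arcwise_bernoulli_indep G p P (edges G) X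
  (fun a => [set a.1; a.2]) (fun=> [set true])) => //.
- exact: edges_arc.
- exact: edge_arc_inj.
- by move=> a /edges_arc /Xlaw.
Qed.

Lemma random_orientation_bernoulli {R : realType} {V : choiceType}
    {G : ugraph V} {d : measure_display} {T : measurableType d}
    {P : probability T R} {h : set V -> T -> V} :
  random_orientation G P h -> arcwise_bernoulli G 2^-1 P (oriented_edge G h).
Proof.
move=> [_ hmeas hlaw hind].
apply: (arcwise_bernoulli_indep G 2^-1 P (edges G) h
  (fun a => [set a.1; a.2]) (fun a => [set a.2])) => //.
- exact: edges_arc.
- exact: edge_arc_inj.
- by move=> a /edges_arc aG; apply: (hlaw _ a.2 aG); right.
Qed.

Lemma directed_percolation_bernoulli {R : realType} {V : choiceType}
    {G : ugraph V} {p : R} {d : measure_display} {T : measurableType d}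
    {P : probability T R} {Y : V * V -> T -> bool} :
  directed_percolation G p P Y -> arcwise_bernoulli G p P (open_arc G Y).
Proof.
move=> [Ymeas Ylaw Yind].
apply: (arcwise_bernoulli_indep G p P (arcs G) Y id (fun=> [set true])) => //.
by move=> a a' _ _ ->; left.
Qed.

(** * The exploration *)

Definition found_arc {V : choiceType} (J : {fset V * V}) (b : V * V -> bool)
    (x y : V) : Prop :=
  (x, y) \in J /\ b (x, y).

(** An open arc that starts in the explored set and has been queried was found,
    so it cannot leave that set; hence the explored set is the whole cluster as
    soon as no open arc leaves it without having been queried. *)
Lemma out_cluster_explored {V : choiceType} {T : Type}
    (r : T -> V -> V -> Prop) (J : {fset V * V}) b (u : V) (t : T) :
  cylinder r J b t ->
  (forall x y, out_cluster (found_arc J b) u x -> r t x y ->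
     (x, y) \notin J -> out_cluster (found_arc J b) u y) ->
  out_cluster (r t) u = out_cluster (found_arc J b) u.
Proof.
move=> Jt live; apply/seteqP; split.
  apply: out_cluster_min; first exact: out_cluster_root.
  move=> x y ux rxy; have [xyJ|] := boolP ((x, y) \in J); last exact: live rxy.
  by apply: out_cluster_step ux _; split => //; apply/(Jt _ xyJ).
by apply: out_cluster_mono => x y [xyJ bxy]; apply/(Jt _ xyJ).
Qed.

Lemma in_cluster_explored {V : choiceType} {T : Type}
    (r : T -> V -> V -> Prop) (J : {fset V * V}) b (w : V) (t : T) :
  cylinder r J b t ->
  (forall x y, in_cluster (found_arc J b) w y -> r t x y ->
     (x, y) \notin J -> in_cluster (found_arc J b) w x) ->
  in_cluster (r t) w = in_cluster (found_arc J b) w.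
Proof.
move=> Jt live; apply/seteqP; split.
  apply: in_cluster_min; first exact: in_cluster_root.
  move=> x y wy rxy; have [xyJ|] := boolP ((x, y) \in J); last exact: live rxy.
  by apply: in_cluster_step wy _; split => //; apply/(Jt _ xyJ).
by apply: in_cluster_mono => x y [xyJ bxy]; apply/(Jt _ xyJ).
Qed.

Definition answer {V : choiceType} (b : V * V -> bool) (a : V * V) (c : bool) :
    V * V -> bool :=
  fun a' => if a' == a then c else b a'.

Lemma found_arc_answer {V : choiceType} {J : {fset V * V}} {b a} (c : bool) :
  a \notin J ->
  forall x y, found_arc J b x y -> found_arc (a |` J)%fset (answer b a c) x y.
Proof.
move=> aJ x y [xyJ bxy]; split; first by rewrite in_fset1U xyJ orbT.
by rewrite /answer; case: eqP => [xya|//]; move: aJ; rewrite -xya xyJ.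
Qed.

Lemma cylinder_answer {V : choiceType} {T : Type} (r : T -> V -> V -> Prop)
    (J : {fset V * V}) b a (c : bool) : a \notin J ->
  cylinder r (a |` J)%fset (answer b a c)
  = cylinder r J b `&` [set t | r t a.1 a.2 <-> c].
Proof.
move=> aJ; apply/seteqP; split => t.
  move=> Jt; split.
    move=> a' a'J; have := Jt a'; rewrite in_fset1U a'J orbT => /(_ isT).
    by rewrite /answer; case: eqP => // e; move: aJ; rewrite -e a'J.
  by have := Jt a; rewrite fset1U1 /answer eqxx; apply.
move=> [Jt at_] a'; rewrite in_fset1U /answer.
by case: eqP => [-> _ //|_ /= a'J]; apply: Jt.
Qed.

Lemma finite_incident_arcs {V : choiceType} (G : ugraph V) (U W : set V) :
  locally_finite G -> finite_set U -> finite_set W ->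
  finite_set [set a | arcs G a /\ (U a.1 \/ W a.2)].
Proof.
move=> hG finU finW.
have : finite_set
    ((\bigcup_(x in U) (pair x @` [set y | adj G x y])) `|`
     (\bigcup_(y in W) (pair^~ y @` [set x | adj G y x]))).
  rewrite finite_setU; split; apply: bigcup_finite => // x _;
    exact: finite_image.
apply: sub_finite_set => -[x y] [/= xy [Ux|Wy]].
  by left; exists x => //; exists y.
by right; exists y => //; exists x => //; apply: adj_sym.
Qed.

(** Two random relations with the same law along asymmetric sets of arcs give
    the same probability to each node of the decision tree, namely a set [J] of
    queried arcs with their answers [b].  The induction is on the number of
    arcs that can still be queried; measurability of the event is obtained
    along with the equality, from the leaves up.  The last hypothesis on [J]
    records why its arcs were queried, which is what keeps [J] free of opposite
    arcs when it grows. *)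
Lemma cluster_law_explored {R : realType} {V : choiceType} {G : ugraph V}
    {p : R} {d1 d2 : measure_display}
    {T1 : measurableType d1} {P1 : probability T1 R} {r1}
    {T2 : measurableType d2} {P2 : probability T2 R} {r2}
    (hG : locally_finite G) {u w : V} {U W : set V}
    (finU : finite_set U) (finW : finite_set W) (UW0 : U `&` W = set0)
    (ab1 : arcwise_bernoulli G p P1 r1) (ab2 : arcwise_bernoulli G p P2 r2)
    (J : {fset V * V}) (b : V * V -> bool) :
  let A := out_cluster (found_arc J b) u in
  let B := in_cluster (found_arc J b) w in
  let ev T (r : T -> V -> V -> Prop) :=
    cylinder r J b `&` [set t | out_cluster (r t) u = U /\
                                in_cluster (r t) w = W] in
  [set` J] `<=` arcs G -> asymmetric_arcs J ->
  (forall x y, (x, y) \in J -> A x \/ B y) ->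
  [/\ measurable (ev T1 r1), measurable (ev T2 r2) &
      P1 (ev T1 r1) = P2 (ev T2 r2)].
Proof.
pose N := fset_set [set a | arcs G a /\ (U a.1 \/ W a.2)].
have NP a : (a \in N) <-> arcs G a /\ (U a.1 \/ W a.2).
  rewrite in_fset_set; last exact: finite_incident_arcs.
  by split => [/set_mem//|aN]; apply/mem_set.
have [n] := ubnP #|` N `\` J|%fset.
elim: n J b => // n IHn J b /ltnSE leNJ A B ev JG Jasym Jfocus.
(* A node at which the event is empty or certain is a leaf. *)
have leaf0 : (forall T r, ev T r = set0) ->
    [/\ measurable (ev T1 r1), measurable (ev T2 r2) &
        P1 (ev T1 r1) = P2 (ev T2 r2)].
  by move=> ev0; rewrite !ev0 !measure0; split => //; apply: measurable0.
have leaf1 : ev T1 r1 = cylinder r1 J b -> ev T2 r2 = cylinder r2 J b ->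
    [/\ measurable (ev T1 r1), measurable (ev T2 r2) &
        P1 (ev T1 r1) = P2 (ev T2 r2)].
  move=> -> ->; rewrite (ab_law _ _ _ _ ab1) // (ab_law _ _ _ _ ab2) //.
  by split => //; [apply: (ab_meas _ _ _ _ ab1)|apply: (ab_meas _ _ _ _ ab2)].
have found T (r : T -> V -> V -> Prop) t : cylinder r J b t ->
    forall x y, found_arc J b x y -> r t x y.
  by move=> Jt x y [xyJ bxy]; apply/(Jt _ xyJ).
have [AU|AU] := pselect (A `<=` U); last first.
  apply: leaf0 => T r; rewrite -subset0 => t [Jt [outU _]].
  by apply: AU; rewrite -outU; apply: out_cluster_mono (found _ _ _ Jt).
have [BW|BW] := pselect (B `<=` W); last first.
  apply: leaf0 => T r; rewrite -subset0 => t [Jt [_ inW]].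
  by apply: BW; rewrite -inW; apply: in_cluster_mono (found _ _ _ Jt).
have AB x : A x -> ~ B x.
  by move=> /AU Ux /BW Wx; suff : set0 x by []; rewrite -UW0.
have [[a [aG aJ live]]|dead] := pselect (exists a, [/\ arcs G a, a \notin J &
    A a.1 /\ ~ A a.2 \/ B a.2 /\ ~ B a.1]); last first.
  have explored T (r : T -> V -> V -> Prop) t :
      (forall t x y, r t x y -> adj G x y) -> cylinder r J b t ->
      out_cluster (r t) u = A /\ in_cluster (r t) w = B.
    move=> radj Jt; split.
      apply: out_cluster_explored => // x y Ax rxy xyJ.
      apply: contrapT => nAy; apply: dead; exists (x, y).
      by split => //; [apply: radj rxy|left].
    apply: in_cluster_explored => // x y By rxy xyJ.
    apply: contrapT => nBx; apply: dead; exists (x, y).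
    by split => //; [apply: radj rxy|right].
  have evE T (r : T -> V -> V -> Prop) :
      (forall t x y, r t x y -> adj G x y) ->
      ev T r = cylinder r J b `&` [set t | A = U /\ B = W].
    move=> radj; apply/seteqP; split => t [Jt];
      by have [eA eB] := explored _ _ _ radj Jt; rewrite /ev /= eA eB.
  have [AUBW|AUBW] := pselect (A = U /\ B = W).
    apply: leaf1.
      rewrite evE; last exact: ab_adj ab1.
      by apply/seteqP; split => t => [[]|].
    rewrite evE; last exact: ab_adj ab2.
    by apply/seteqP; split => t => [[]|].
  have ev0 T (r : T -> V -> V -> Prop) :
      (forall t x y, r t x y -> adj G x y) -> ev T r = set0.
    by move=> radj; rewrite evE // -subset0 => t [].
  rewrite (ev0 _ _ (ab_adj _ _ _ _ ab1)) (ev0 _ _ (ab_adj _ _ _ _ ab2)).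
  by rewrite !measure0; split => //; apply: measurable0.
(* The opposite of a queryable arc has not been queried before: this would
   put one of its ends into both explored sets. *)
have oppJ : (a.2, a.1) \notin J.
  apply/negP => /Jfocus [A2|B1].
    by case: live => -[// /(AB _ A2)].
  by case: live => -[A1 //]; case: (AB _ A1 B1).
pose J' := (a |` J)%fset.
have branch c : let b' := answer b a c in
  let ev' T (r : T -> V -> V -> Prop) :=
    cylinder r J' b' `&` [set t | out_cluster (r t) u = U /\
                                  in_cluster (r t) w = W] in
  [/\ measurable (ev' T1 r1), measurable (ev' T2 r2) &
      P1 (ev' T1 r1) = P2 (ev' T2 r2)].
  move=> b' ev'.
  have AA' : A `<=` out_cluster (found_arc J' b') u.
    exact: out_cluster_mono (found_arc_answer c aJ).
  have BB' : B `<=` in_cluster (found_arc J' b') w.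
    exact: in_cluster_mono (found_arc_answer c aJ).
  apply: IHn.
  - have aN : a \in N.
      apply/NP; split => //.
      by case: live => -[? _]; [left; apply: AU|right; apply: BW].
    apply: leq_trans leNJ; rewrite [ltnRHS](cardfsD1 a) fsetDDl fsetUC.
    by rewrite in_fsetD aJ aN.
  - by move=> a' /=; rewrite in_fset1U => /orP[/eqP ->|/JG].
  - move=> x y; rewrite !in_fset1U negb_or => /orP[/eqP xya|xyJ].
      have -> : (y, x) = (a.2, a.1) by rewrite -xya.
      rewrite oppJ andbT; apply/eqP => e; move: aG; rewrite -e /arcs /=.
      by move: e; rewrite -xya => -[-> _]; apply: adj_irrefl.
    rewrite Jasym // andbT; apply/eqP => yxa.
    by move: oppJ; rewrite -yxa xyJ.
  - move=> x y; rewrite in_fset1U => /orP[/eqP xya|/Jfocus [/AA'|/BB']].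
    + case: live; rewrite -xya /= => -[? _].
        by left; apply: AA'.
      by right; apply: BB'.
    + by left.
    + by right.
have split_ev T (r : T -> V -> V -> Prop) : ev T r =
    (cylinder r J' (answer b a true) `&` [set t | out_cluster (r t) u = U /\
       in_cluster (r t) w = W]) `|`
    (cylinder r J' (answer b a false) `&` [set t | out_cluster (r t) u = U /\
       in_cluster (r t) w = W]).
  rewrite -setIUl /J' !cylinder_answer // -setIUr; congr (_ `&` _).
  rewrite -[LHS]setIT; congr (_ `&` _); apply/esym/seteqP; split => // t _.
  by have [rt|rt] := pselect (r t a.1 a.2); [left|right]; split.
have disj_ev T (r : T -> V -> V -> Prop) :
    (cylinder r J' (answer b a true) `&` [set t | out_cluster (r t) u = U /\
       in_cluster (r t) w = W]) `&`
    (cylinder r J' (answer b a false) `&` [set t | out_cluster (r t) u = U /\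
       in_cluster (r t) w = W]) = set0.
  rewrite /J' !cylinder_answer // -subset0.
  by move=> t [[[_ [_ /(_ isT) rt]] _] [[_ [/(_ rt)]]]].
have [m1 m2 e12] := branch true; have [m1' m2' e12'] := branch false.
rewrite !split_ev; split; [exact: measurableU|exact: measurableU|].
rewrite (measureU P1 m1 m1') ?disj_ev // (measureU P2 m2 m2') ?disj_ev //.
by congr (_ + _)%E.
Qed.

Lemma cluster_law_eq {R : realType} {V : choiceType} {G : ugraph V}
    {p : R} {d1 d2 : measure_display}
    {T1 : measurableType d1} {P1 : probability T1 R} {r1}
    {T2 : measurableType d2} {P2 : probability T2 R} {r2}
    (hG : locally_finite G) (u w : V) {U W : set V}
    (finU : finite_set U) (finW : finite_set W) (UW0 : U `&` W = set0) :
  arcwise_bernoulli G p P1 r1 -> arcwise_bernoulli G p P2 r2 ->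
  P1 [set t | out_cluster (r1 t) u = U /\ in_cluster (r1 t) w = W]
  = P2 [set t | out_cluster (r2 t) u = U /\ in_cluster (r2 t) w = W].
Proof.
move=> ab1 ab2.
have [] := @cluster_law_explored _ _ _ _ _ _ _ _ _ _ _ _ hG u w _ _
  finU finW UW0 ab1 ab2 fset0 (fun=> false) => // _ _.
have cyl0 T (r : T -> V -> V -> Prop) :
    cylinder r fset0 (fun=> false) = setT.
  by apply/seteqP; split.
by rewrite !cyl0 !setTI.
Qed.

Lemma edge_cluster_in {V : choiceType} (G : ugraph V) {T : Type}
    (X : set V -> T -> bool) (t : T) (v : V) :
  edge_cluster G X t v = in_cluster (open_edge G X t) v.
Proof.
rewrite in_cluster_sym // => x y [xy Xxy].
by split; [apply: adj_sym|rewrite setUC].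
Qed.

Theorem lemma2p2 (R : realType) (V : choiceType) (G : ugraph V)
    (hG : locally_finite G) (u w : V) (U W : set V)
    (finU : finite_set U) (finW : finite_set W)
    (uU : U u) (wW : W w) (UW0 : U `&` W = set0) :
  (forall (dE : measure_display) (TE : measurableType dE)
      (PE : probability TE R) (X : set V -> TE -> bool)
      (dO : measure_display) (TO : measurableType dO)
      (PO : probability TO R) (h : set V -> TO -> V)
      (dD : measure_display) (TD : measurableType dD)
      (PD : probability TD R) (Y : V * V -> TD -> bool),
    edge_percolation G 2^-1 PE X ->
    random_orientation G PO h ->
    directed_percolation G 2^-1 PD Y ->
    PE [set t | edge_cluster G X t u = U /\ edge_cluster G X t w = W]
    = PO [set t | out_cluster (oriented_edge G h t) u = U /\
                  in_cluster (oriented_edge G h t) w = W]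
    /\
    PO [set t | out_cluster (oriented_edge G h t) u = U /\
                in_cluster (oriented_edge G h t) w = W]
    = PD [set t | out_cluster (open_arc G Y t) u = U /\
                  in_cluster (open_arc G Y t) w = W])
  /\
  (forall p : R, 0 <= p <= 1 ->
    forall (dE : measure_display) (TE : measurableType dE)
      (PE : probability TE R) (X : set V -> TE -> bool)
      (dD : measure_display) (TD : measurableType dD)
      (PD : probability TD R) (Y : V * V -> TD -> bool),
    edge_percolation G p PE X ->
    directed_percolation G p PD Y ->
    PE [set t | edge_cluster G X t u = U /\ edge_cluster G X t w = W]
    = PD [set t | out_cluster (open_arc G Y t) u = U /\
                  in_cluster (open_arc G Y t) w = W]).
Proof.
have edgeE dE (TE : measurableType dE) (X : set V -> TE -> bool) :
    [set t | edge_cluster G X t u = U /\ edge_cluster G X t w = W]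
    = [set t | out_cluster (open_edge G X t) u = U /\
               in_cluster (open_edge G X t) w = W].
  by apply: eq_set => t; rewrite -edge_cluster_in.
split => [dE TE PE X dO TO PO h dD TD PD Y|p _ dE TE PE X dD TD PD Y].
  move=> /edge_percolation_bernoulli abE /random_orientation_bernoulli abO.
  move=> /directed_percolation_bernoulli abD.
  rewrite edgeE; split.
    exact: (cluster_law_eq hG u w finU finW UW0 abE abO).
  exact: (cluster_law_eq hG u w finU finW UW0 abO abD).
move=> /edge_percolation_bernoulli abE /directed_percolation_bernoulli abD.
by rewrite edgeE; exact: (cluster_law_eq hG u w finU finW UW0 abE abD).
Qed.
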